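(* Let $d\ge 4$ be an integer. A general surface of degree $d$ in $\mathbb{P}^3$ (over $\mathbb{C}$) is not a Poncelet surface; that is, there is a nonempty Zariski open subset $U$ of the projective space of all surfaces of degree $d$ in $\mathbb{P}^3$ such that no surface in $U$ is a Poncelet surface.
   Context: Work over $\mathbb{C}$. Let $V$ be a complex vector space of dimension $2$ and $S_i=\mathrm{Sym}^i(V)$, viewed as the space of binary forms of degree $i$ (so $\dim S_i=i+1$). Let $\mathbb{P}(S_n^\vee)\cong\mathbb{P}^n$ denote the projective space whose points are the lines $[h]$ in $S_n$, so that its linear forms are the elements of $S_n^\vee$. For integers $n\ge 1$, $k\ge 0$, multiplication of binary forms $S_k\otimes S_n\to S_{n+k}$ defines the Schwarzenberger bundle $E_{n,n+k}$, of rank $n$ on $\mathbb{P}(S_n^\vee)$, by the exact sequence $$0\to S_k\otimes\mathcal{O}_{\mathbb{P}(S_n^\vee)}(-1)\to S_{n+k}\otimes\mathcal{O}_{\mathbb{P}(S_n^\vee)}\to E_{n,n+k}\to 0,$$ where at the point $[h]$ the first map is $g\mapsto gh$. One has $H^0(E_{n,n+k})\cong S_{n+k}$, so binary forms of degree $n+k$ are sections of $E_{n,n+k}$. For $1\le r\le n$ and linearly independent sections $f_1,\dots,f_r\in S_{n+k}$ of $E_{n,n+k}$, the Poncelet variety defined by them is the closed subscheme of $\mathbb{P}(S_n^\vee)$ with equation $f_1\wedge\cdots\wedge f_r=0$ (vanishing of this section of $\bigwedge^r E_{n,n+k}$). When $r=n$ it is a Poncelet hypersurface of degree $k+1$; writing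 $\Lambda=\langle f_1,\dots,f_n\rangle$, its equation is the determinant of the induced $(k+1)\times(k+1)$ matrix of linear forms $S_k\otimes\mathcal{O}(-1)\to (S_{n+k}/\Lambda)\otimes\mathcal{O}$. A subscheme of $\mathbb{P}^n$ is called a Poncelet variety (hypersurface) if it becomes one under some linear isomorphism $\mathbb{P}^n\cong\mathbb{P}(S_n^\vee)$ (equivalently, for some choice of a rational normal curve in $\mathbb{P}^n$). A Poncelet surface of degree $d$ is a Poncelet hypersurface in $\mathbb{P}^3$ with $n=3$, $k=d-1$. *)

(* Defs.v *)
(* Mathematical Components, with multinomials for polynomials in several
   variables and real-closed for the complex numbers R[i]. *)
From HB Require Import structures.
From mathcomp Require Import all_boot all_order all_algebra.
From mathcomp Require Import reals complex.
From mathcomp Require Import mpoly.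

Set Implicit Arguments.
Unset Strict Implicit.
Unset Printing Implicit Defensive.

Import GRing.Theory.
Local Open Scope ring_scope.

(* S_i = Sym^i(V) for V = K^2 with basis 'X_0, 'X_1. *)
Definition bform (K : fieldType) (i : nat) : vectType K := dhomog 2 K i.

Definition bform_mul (K : fieldType) (m n : nat) (g : bform K m)
    (h : bform K n) : bform K (m + n) :=
  DHomog (dhomogM (dhomog_is_dhomog g) (dhomog_is_dhomog h)).

Definition bform_mono_mnm (i : nat) (j : 'I_i.+1) : 'X_{1..2} :=
  [multinom (if l == ord0 :> 'I_2 then i - j else j)%N | l < 2].

Lemma bform_mono_homog (K : fieldType) (i : nat) (j : 'I_i.+1) :
  'X_[K, bform_mono_mnm j] \is [in K[2], i.-homog].
Proof.
rewrite dhomogX /= mdegE !big_ord_recl big_ord0 !mnmE /= addn0.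
by rewrite subnK // -ltnS.
Qed.

(* The monomial basis 'X_0^(i - j) 'X_1^j, 0 <= j <= i, of S_i. *)
Definition bform_mono (K : fieldType) (i : nat) (j : 'I_i.+1) : bform K i :=
  DHomog (bform_mono_homog K j).

(* The homogeneous coordinate ring of P(S_n^vee), the space of lines [h] in S_n,
   is {mpoly K[n.+1]}: the variable 'X_j is the coordinate of h dual to
   bform_mono j, so that \sum_j 'X_j (bform_mono j) is the universal form h.
   If q : S_(n+k) -> K^(k+1) is onto with kernel Lambda, it identifies
   S_(n+k) / Lambda with K^(k+1); the matrix below is then that of
     S_k (x) O(-1) -> (S_(n+k) / Lambda) (x) O,   g |-> g h mod Lambda,
   with row vectors, in the monomial basis of S_k. *)
Definition poncelet_matrix (K : fieldType) (n k : nat)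
    (q : 'Hom(bform K (n + k), 'rV[K]_k.+1)) : 'M[{mpoly K[n.+1]}]_k.+1 :=
  \matrix_(a < k.+1, b < k.+1) \sum_(j < n.+1)
    (q (bform_mul (bform_mono K j) (bform_mono K a))) 0 b *: 'X_j.

(* D is an equation of the Poncelet hypersurface of P(S_n^vee) defined by some
   linearly independent sections f_1, ..., f_n in S_(n+k) of E_(n,n+k). Another
   choice of q for the same f multiplies D by a nonzero constant. *)
Definition poncelet_equation (K : fieldType) (n k : nat)
    (D : {mpoly K[n.+1]}) : Prop :=
  exists (f : n.-tuple (bform K (n + k)))
         (q : 'Hom(bform K (n + k), 'rV[K]_k.+1)),
    [/\ free f, lker q = <<f>>%VS, limg q = fullv
      & D = \det (poncelet_matrix q)].

(* Pullback of D along the linear map with matrix A. *)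
Definition linear_subst (K : fieldType) (m : nat) (A : 'M[K]_m)
    (D : {mpoly K[m]}) : {mpoly K[m]} :=
  D \mPo [tuple \sum_(j < m) A i j *: 'X_j | i < m].

(* The hypersurface F = 0 of P^n becomes, under some linear isomorphism
   P^n = P(S_n^vee), a Poncelet hypersurface of degree k + 1. Two forms define
   the same closed subscheme iff they agree up to a nonzero constant. *)
Definition poncelet_hypersurface (K : fieldType) (n k : nat)
    (F : {mpoly K[n.+1]}) : Prop :=
  exists (A : 'M[K]_n.+1) (D : {mpoly K[n.+1]}) (c : K),
    [/\ A \in unitmx, poncelet_equation k D, c != 0
      & F = c *: linear_subst A D].

Definition poncelet_surface (K : fieldType) (d : nat)
    (F : {mpoly K[4]}) : Prop :=
  @poncelet_hypersurface K 3 d.-1 F.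

(* Value at w of a polynomial in the coordinates of the vector space W. *)
Definition eval_at (K : fieldType) (W : vectType K)
    (G : {mpoly K[\dim {:W}]}) (w : W) : K :=
  G.@[fun i => coord (vbasis {:W}) i w].

(* Points of the projective space of lines in W are represented by nonzero
   vectors w : W; the value of U at 0 is irrelevant. U is the complement of the
   common zeros of a family of homogeneous polynomials, which makes it
   invariant under nonzero scalings. *)
Definition proj_zariski_open (K : fieldType) (W : vectType K)
    (U : W -> Prop) : Prop :=
  exists Gs : {mpoly K[\dim {:W}]} -> Prop,
    (forall G, Gs G -> exists e : nat, G \is e.-homog) /\
    (forall w : W, w != 0 ->
       (U w <-> exists2 G, Gs G & eval_at G w != 0)).

(* Main.v *)
Require Import Defs.
From HB Require Import structures.
From mathcomp Require Import all_boot all_order all_algebra.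
From mathcomp Require Import reals complex.
From mathcomp Require Import mpoly.

Import GRing.Theory.
Local Open Scope ring_scope.

(** The theorem is a dimension count. A Poncelet hypersurface of degree k + 1 in
    P^n comes from a quotient q of S_(n+k) of dimension k + 1 and a linear
    change of coordinates A. The quotient is a matrix with n + k + 1 rows and
    k + 1 columns, of full rank; multiplying it on the right by an invertible
    matrix only scales the determinant (poncelet_formM), so it can be
    normalized to have the identity in k + 1 of its rows (row_full_pivot). What
    is left is n (k + 1) entries of q, (n + 1)^2 entries of A and one scalar. So
    the equations of Poncelet hypersurfaces are covered by the images of
    finitely many polynomial maps, one for each position of the identity rows
    (poncelet_normal_form), from an affine space of dimension
    m = n (k + 1) + (n + 1)^2 + 1 to the space of forms of degree k + 1, whose
    dimension is N = C(k + 1 + n, n). For n = 3 and d = k + 1 >= 4 one has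
    m + 1 = 3 d + 18 < C(d + 3, 3) = N (parameter_count); the crude count, with
    all entries of q free, would not do for d = 4.

    When m + 1 < N the image of such a map lies in the zero set of a nonzero
    homogeneous polynomial G (homogeneous_relation): among the homogeneous
    polynomials of degree s in N variables there are of the order of s^(N-1)
    monomials, and after substitution they lie in a space of polynomials in m
    variables of dimension of the order of s^m, so for large s some nontrivial
    combination vanishes. The product of these G over the finitely many maps
    vanishes on all Poncelet hypersurfaces, and U is the set where it does not
    vanish. It has a point because a nonzero polynomial over an infinite field
    takes a nonzero value (mpoly_nonroot). *)

(** * Nonzero values of polynomials in several variables *)

Lemma poly_nonroot (K : numFieldType) (p : {poly K}) :
  p != 0 -> exists t : K, p.[t] != 0.
Proof.
move=> p0; pose s := [seq i%:R : K | i <- iota 0 (size p)].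
have us : uniq s.
  rewrite map_inj_uniq ?iota_uniq // => i j /eqP.
  by rewrite Num.Theory.eqr_nat => /eqP.
have : ~~ all (root p) s.
  apply/negP => rs; have := max_poly_roots p0 rs us.
  by rewrite size_map size_iota ltnn.
by case/allPn=> t _ nt; exists t.
Qed.

(** As muni isolates the last variable, this says that no coefficient is lost,
    hence that muni is injective. *)
Lemma muni_coef (n : nat) (R : nzRingType) (p : {mpoly R[n.+1]})
    (m : 'X_{1..n.+1}) :
  (muni p)`_(m ord_max)@_[multinom m (widen_ord (leqnSn n) i) | i < n] = p@_m.
Proof.
rewrite muniE coef_sum raddf_sum /=.
have E m0 :
    (p@_m0 *: 'X_[[multinom m0 (widen_ord (leqnSn n) i) | i < n]]
       *: 'X^(m0 ord_max) : {poly {mpoly R[n]}})`_(m ord_max)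
      @_[multinom m (widen_ord (leqnSn n) i) | i < n]
    = p@_m0 * (m0 == m)%:R.
  rewrite coefZ coefXn mulr_natr mcoeffMn mcoeffZ mcoeffX -mulrnAr -mulrnA mulnb.
  congr (_ * (nat_of_bool _)%:R); apply/andP/eqP => [[/eqP e1 /eqP e2]|->] //.
  apply/mnmP => i; case: (unliftP ord_max i) => [j|] ->; last by [].
  have := congr1 (fun m' : 'X_{1..n} => m' j) e1; rewrite !mnmE.
  rewrite (_ : lift ord_max j = widen_ord (leqnSn n) j) //.
  by apply: val_inj; rewrite /= /bump leqNgt ltn_ord.
rewrite (eq_bigr _ (fun m0 _ => E m0)).
have [ms|ms] := boolP (m \in msupp p).
  rewrite (bigD1_seq m) ?msupp_uniq //= eqxx mulr1 big1 ?addr0 // => i /negbTE ->.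
  by rewrite mulr0.
rewrite (memN_msupp_eq0 ms) big_seq big1 // => i ip.
by case: eqP ms => [<-|]; rewrite ?ip ?mulr0.
Qed.

Lemma muni_eval (n : nat) (R : comNzRingType) (p : {mpoly R[n.+1]}) (w : 'I_n.+1 -> R) :
  (map_poly (meval (w \o widen_ord (leqnSn n))) (muni p)).[w ord_max] = p.@[w].
Proof.
rewrite muniE raddf_sum horner_sum mevalE; apply: eq_bigr => m _.
rewrite /= map_polyZ /= map_polyXn hornerZ hornerXn mevalZ mevalX -mulrA.
congr (_ * _); rewrite big_ord_recr /=; congr (_ * _).
by apply: eq_bigr => i _; rewrite mnmE.
Qed.

(** Induction on the number of variables: a point where the leading coefficient
    in the last variable does not vanish leaves a nonzero polynomial in that
    variable. *)
Lemma mpoly_nonroot (K : numFieldType) (n : nat) (p : {mpoly K[n]}) :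
  p != 0 -> exists v : 'I_n -> K, p.@[v] != 0.
Proof.
elim: n p => [|n IH] p p0.
  have [m mp] : exists m, m \in msupp p.
    by exists (mlead p); apply: mlead_supp.
  exists (fun=> 0); rewrite (mpolyE p) raddf_sum /= (bigD1_seq m) ?msupp_uniq //=.
  rewrite big1 => [|m' /eqP []]; last by apply/mnmP; case.
  by rewrite addr0 mevalZ mevalX big_ord0 mulr1 -mcoeff_msupp.
have q0 : muni p != 0.
  apply: contraNneq p0 => q0; apply/eqP/mpolyP => m.
  by rewrite -muni_coef q0 coef0 !mcoeff0.
have /IH[v vq] : lead_coef (muni p) != 0 by rewrite lead_coef_eq0.
have /poly_nonroot [t tq] : map_poly (meval v) (muni p) != 0.
  apply: contraNneq vq => /(congr1 (fun f : {poly K} => f`_(size (muni p)).-1)).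
  by rewrite coef_map coef0 lead_coefE => ->.
pose w (i : 'I_n.+1) := oapp v t (insub (val i)).
exists w; rewrite -muni_eval.
suff -> : w ord_max = t.
  rewrite (eq_map_poly (g := meval v)) // => x; apply: meval_eq => i.
  by rewrite /w /= insubT //= => lti; congr v; apply: val_inj.
by rewrite /w /= insubF // ltnn.
Qed.

(** * Homogeneous relations between polynomials in few variables *)

Lemma linear_dependence (K : fieldType) (I J : finType) (M : I -> J -> K) :
  (#|J| < #|I|)%N ->
  exists2 u : I -> K, exists i, u i != 0 & forall j, \sum_i u i * M i j = 0.
Proof.
move=> JI; pose A := \matrix_(i < #|I|, j < #|J|) M (enum_val i) (enum_val j).
have /rowV0Pn [v /sub_kermxP vA v0] : kermx A != 0.
  rewrite kermx_eq0 /row_free neq_ltn (leq_ltn_trans (rank_leq_col A)) //.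
have [i vi] : exists i, v 0 i != 0 by apply/rV0Pn.
exists (fun i => v 0 (enum_rank i)) => [|j].
  by exists (enum_val i); rewrite enum_valK.
have /matrixP /(_ 0 (enum_rank j)) := vA; rewrite !mxE; apply: etrans.
rewrite (reindex (@enum_val I I)) /=; last by apply: onW_bij; apply: enum_val_bij.
by apply: eq_bigr => k _; rewrite !mxE enum_valK enum_rankK.
Qed.

Lemma msizeM_bound (K : fieldType) (m : nat) (p q : {mpoly K[m]}) (a b : nat) :
  (msize p <= a.+1 -> msize q <= b.+1 -> msize (p * q) <= (a + b).+1)%N.
Proof.
have [->|p0] := eqVneq p 0; first by rewrite mul0r msize0.
have [->|q0] := eqVneq q 0; first by rewrite mulr0 msize0.
move=> pa qb; rewrite msizeM //.
by have := leq_add pa qb; rewrite addSn addnS; case: (_ + _)%N.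
Qed.

Lemma msizeX_bound (K : fieldType) (m : nat) (p : {mpoly K[m]}) (a e : nat) :
  (msize p <= a.+1 -> msize (p ^+ e) <= (a * e).+1)%N.
Proof.
move=> pa; elim: e => [|e IH]; first by rewrite expr0 msize1.
by rewrite exprS mulnS msizeM_bound.
Qed.

Lemma msize_comp_mpolyX (K : fieldType) (N m a : nat)
    (p : N.-tuple {mpoly K[m]}) (mon : 'X_{1..N}) :
  (forall i, msize (tnth p i) <= a.+1)%N ->
  (msize ('X_[mon] \mPo p) <= (a * mdeg mon).+1)%N.
Proof.
move=> pa; rewrite comp_mpolyX mdegE big_distrr /=.
elim/big_rec2: _ => [|i b q _ IH]; first by rewrite msize1.
by apply: msizeM_bound => //; apply: msizeX_bound.
Qed.

(** The left side has degree m in t and the right side has degree n. *)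
Lemma box_count (a n m : nat) :
  (m < n)%N -> exists t, ((a * (n * t)).+1 ^ m < t.+1 ^ n)%N.
Proof.
move=> mn; set C := (a * n).+1; exists (C ^ m)%N; set t := (C ^ m)%N.
apply: (@leq_ltn_trans ((C * t.+1) ^ m)%N).
  case: m mn @t => [|m] mn t //; rewrite leq_exp2r //.
  by rewrite /C mulSn mulnA addSn ltnS (leq_trans _ (leq_addl _ _)) // leq_mul.
rewrite expnMn; apply: (@leq_trans (t.+1 ^ m.+1)%N).
  by rewrite expnS ltn_pmul2r ?expn_gt0.
by rewrite leq_pexp2l.
Qed.

(** The monomial of degree s whose first n exponents are al: the last exponent
    makes up the degree. Since n of the n + 1 exponents are free, it is n, and
    not n + 1, that has to exceed the number of parameters. *)
Definition box_mnm (n s : nat) (al : 'I_n -> nat) : 'X_{1..n.+1} :=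
  [multinom if unlift ord_max i is Some j then al j else (s - \sum_j al j)%N | i < n.+1].

Lemma box_mnm_deg (n s : nat) (al : 'I_n -> nat) :
  (\sum_j al j <= s)%N -> mdeg (box_mnm n s al) = s.
Proof.
move=> als; rewrite mdegE big_ord_recr /= mnmE unlift_none.
under eq_bigr => i _.
  have -> : widen_ord (leqnSn n) i = lift ord_max i.
    by apply: val_inj; rewrite /= /bump leqNgt ltn_ord.
  by rewrite mnmE liftK over.
by rewrite subnKC.
Qed.

Lemma box_mnm_inj (n s : nat) (al be : 'I_n -> nat) :
  box_mnm n s al = box_mnm n s be -> al =1 be.
Proof.
move=> e j; have := congr1 (fun m : 'X_{1..n.+1} => m (lift ord_max j)) e.
by rewrite !mnmE liftK.
Qed.

(** The monomials box_mnm with exponents at most t in the first n variables are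
    more numerous than the monomials in m variables that can occur when p is
    substituted into them, by box_count. *)
Lemma homogeneous_relation (K : fieldType) (N m : nat)
    (p : N.-tuple {mpoly K[m]}) : (m.+1 < N)%N ->
  exists G : {mpoly K[N]},
    [/\ G != 0, exists e : nat, G \is e.-homog & G \mPo p = 0].
Proof.
case: N p => // n p; rewrite ltnS => mn.
pose a := \max_i msize (tnth p i).
have pa i : (msize (tnth p i) <= a.+1)%N.
  by rewrite ltnW // ltnS /a (leq_bigmax (F := fun i => msize (tnth p i))).
have [t tP] := box_count a n m mn.
pose s := (n * t)%N.
pose I := {ffun 'I_n -> 'I_t.+1}; pose J := {ffun 'I_m -> 'I_(a * s).+1}.
pose mon (al : I) := box_mnm n s (fun j => al j).
have mon_deg al : mdeg (mon al) = s.
  apply: box_mnm_deg; rewrite [s](_ : _ = \sum_(j < n) t)%N; last first.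
    by rewrite sum_nat_const card_ord.
  by apply: leq_sum => j _; rewrite -ltnS.
have mon_inj : injective mon.
  by move=> al be /box_mnm_inj e; apply/ffunP => j; apply/val_inj/e.
have JI : (#|J| < #|I|)%N by rewrite !card_ffun !card_ord.
pose cmon (be : J) : 'X_{1..m} := [multinom val (be i) | i < m].
have [u [al0 ual0] uP] := linear_dependence K I J
  (fun al be => ('X_[mon al] \mPo p)@_(cmon be)) JI.
exists (\sum_al u al *: 'X_[mon al]); split.
- apply: contraNneq ual0 => /(congr1 (mcoeff (mon al0))).
  rewrite raddf_sum mcoeff0 /= (bigD1 al0) //= big1 => [|al ne].
    by rewrite mcoeffZ mcoeffX eqxx mulr1 addr0 => ->.
  by rewrite mcoeffZ mcoeffX (inj_eq mon_inj) (negbTE ne) mulr0.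
- exists s; apply: rpred_sum => al _; apply: rpredZ.
  by rewrite dhomogX; apply/eqP/mon_deg.
- rewrite raddf_sum; apply/mpolyP => m0; rewrite mcoeff0 raddf_sum /=.
  under eq_bigr => al _ do rewrite comp_mpolyZ mcoeffZ.
  (* Beyond the degree bound all coefficients vanish for degree reasons. *)
  have [m0s|m0s] := leqP (a * s).+1 (mdeg m0).
    rewrite big1 // => al _; rewrite memN_msupp_eq0 ?mulr0 // msize_mdeg_ge //.
    by apply: leq_trans m0s; rewrite -(mon_deg al); apply: msize_comp_mpolyX.
  (* The monomial m0 is one of those that occur in the system solved by u. *)
  have m0b i : (m0 i < (a * s).+1)%N.
    by apply: leq_ltn_trans m0s; rewrite mdegE (bigD1 i) //= leq_addr.
  pose be : J := [ffun i => Ordinal (m0b i)].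
  rewrite -[RHS](uP be); apply: eq_bigr => al _; congr (_ * _@__).
  by apply/mnmP => i; rewrite mnmE ffunE.
Qed.

Lemma common_homogeneous_relation (K : fieldType) (I : finType) (N m : nat)
    (p : I -> N.-tuple {mpoly K[m]}) : (m.+1 < N)%N ->
  exists G : {mpoly K[N]},
    [/\ G != 0, exists e : nat, G \is e.-homog & forall i, G \mPo p i = 0].
Proof.
move=> mN; have [G_ GP] :=
  fin_all_exists (fun i => homogeneous_relation K N m (p i) mN).
exists (\prod_i G_ i); split.
- by apply/prodf_neq0 => i _; have [] := GP i.
- have [e eP] : exists e : I -> nat, forall i, G_ i \is (e i).-homog.
    have h i : exists e : nat, G_ i \is e.-homog by case: (GP i).
    exact: (fin_all_exists h).
  exists (\sum_i e i)%N; elim/big_rec2: _ => [|i x q _ IH]; first exact: dhomog1.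
  exact: dhomogM.
- by move=> i; have [_ _ G0] := GP i; rewrite (bigD1 i) //= rmorphM /= G0 mul0r.
Qed.

(** * Coordinates on the space of forms *)

Lemma dhomog_sum_mono (K : fieldType) (n d : nat) (F : dhomog n.+1 K d) :
  F = \sum_(mu : 'X_{1..n.+1 < d.+1}) F@_mu *: ['dhomog_d 'X_[mu]].
Proof.
have Fd := dhomog_is_dhomog F.
have [F0|F0] := eqVneq (mpoly_of_dhomog F) 0.
  by rewrite big1 => [|mu _]; [apply: val_inj | rewrite F0 mcoeff0 scale0r].
apply: val_inj; rewrite /= [LHS](mpolywE (k := d.+1)); last first.
  rewrite msizeE; apply/bigmax_leqP_seq => mu muF _.
  by rewrite (dhomog_mf Fd).
rewrite raddf_sum; apply: eq_bigr => mu _ /=.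
have [mud|mud] := eqVneq (mdeg mu) d.
  by rewrite /indhomog insubdK // unfold_in dhomogX; apply/eqP.
by rewrite (dhomog_nemf_coeff Fd mud) !scale0r.
Qed.

(** The coordinates of the form of degree d obtained from U by specializing the
    m parameters, as polynomials in these parameters. *)
Definition coords_poly {K : fieldType} {m n : nat} (d : nat)
    (U : {mpoly {mpoly K[m]}[n.+1]}) :
    (\dim {:dhomog n.+1 K d}).-tuple {mpoly K[m]} :=
  [tuple \sum_(mu : 'X_{1..n.+1 < d.+1})
     coord (vbasis {:dhomog n.+1 K d}) j ['dhomog_d 'X_[mu]] *: U@_mu | j < _].

Lemma eval_at_specialization (K : fieldType) (m n d : nat)
    (U : {mpoly {mpoly K[m]}[n.+1]}) (x : 'I_m -> K) (F : dhomog n.+1 K d)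
    (G : {mpoly K[\dim {:dhomog n.+1 K d}]}) :
  F = map_mpoly (meval x) U :> {mpoly K[n.+1]} ->
  eval_at G F = (G \mPo coords_poly d U).@[x].
Proof.
move=> FU; rewrite comp_mpoly_meval; apply: meval_eq => j.
rewrite tnth_mktuple [in LHS](dhomog_sum_mono K n d F) !raddf_sum /=.
apply: eq_bigr => mu _.
by rewrite linearZ /= mevalZ mulrC FU mcoeff_map_mpoly.
Qed.

(** * The determinant of a Poncelet hypersurface *)

Lemma bform_mono_span (K : fieldType) (i : nat) (h : bform K i) :
  h = \sum_(j < i.+1) h@_(bform_mono_mnm j) *: bform_mono K j.
Proof.
apply: val_inj; rewrite raddf_sum /=; apply/mpolyP => mu.
rewrite raddf_sum /=.
under eq_bigr => j _ do rewrite mcoeffZ mcoeffX.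
(* A monomial of degree i is determined by its exponent in the last variable. *)
have [mui|mui] := eqVneq (mdeg mu) i; last first.
  rewrite (dhomog_nemf_coeff (dhomog_is_dhomog h) mui) big1 // => j _.
  case: eqP => [e|]; last by rewrite mulr0.
  have := bform_mono_homog K j; rewrite dhomogX e => /eqP mui'.
  by rewrite mui' eqxx in mui.
have mu1 : (mu ord_max < i.+1)%N.
  by rewrite ltnS -mui mdegE big_ord_recr leq_addl.
have e j : (bform_mono_mnm j == mu) = (j == Ordinal mu1).
  apply/eqP/eqP => [e|->]; first by apply: val_inj; rewrite /= -e mnmE.
  apply/mnmP => l; rewrite mnmE; case: eqP => [->|l0] /=.
    rewrite -[i in LHS]mui mdegE big_ord_recr big_ord_recr big_ord0 /= addnK.
    by congr (mu _); apply: val_inj.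
  by congr (mu _); apply: val_inj; case: l l0 => -[|[|l]] //= ll []; apply: val_inj.
rewrite (bigD1 (Ordinal mu1)) //= big1 => [|j /negbTE ne].
  by rewrite e eqxx mulr1 addr0; congr (_@__); apply/esym/eqP; rewrite e.
by rewrite e ne mulr0.
Qed.

Lemma bform_mul_mono (K : fieldType) (n k : nat) (j : 'I_n.+1) (a : 'I_k.+1) :
  bform_mul (bform_mono K j) (bform_mono K a)
    = bform_mono K (inord (j + a) : 'I_(n + k).+1).
Proof.
have ja : (j + a < (n + k).+1)%N by rewrite ltnS leq_add // -ltnS.
apply: val_inj; rewrite /= -mpolyXD; congr 'X_[_].
apply/mnmP => l; rewrite mnmDE !mnmE inordK //; case: eqP => // _.
apply/eqP; rewrite -(eqn_add2r (j + a)) addnACA !subnK //.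
  by rewrite -ltnS.
by rewrite -ltnS.
Qed.

(** The determinant of g |-> g h mod Lambda in the coordinates given by A, where
    B is the matrix of the quotient map from S_(n+k) in the monomial basis. The
    base is a ring so that B and A can have indeterminates as entries. *)
Definition poncelet_form {R : comNzRingType} {n k : nat}
    (B : 'M[R]_((n + k).+1, k.+1)) (A : 'M[R]_n.+1) : {mpoly R[n.+1]} :=
  \det (\matrix_(a < k.+1, b < k.+1)
    \sum_(j < n.+1) B (inord (j + a)) b *: \sum_(l < n.+1) A j l *: 'X_l).

Lemma linear_subst_poncelet (K : fieldType) (n k : nat)
    (q : 'Hom(bform K (n + k), 'rV[K]_k.+1)) (A : 'M[K]_n.+1) :
  linear_subst A (\det (poncelet_matrix q))
    = poncelet_form (\matrix_(i, b) q (bform_mono K i) 0 b) A.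
Proof.
rewrite /linear_subst -det_map_mx; congr (\det _); apply/matrixP => a b.
rewrite !mxE raddf_sum; apply: eq_bigr => j _ /=.
rewrite comp_mpolyZ comp_mpolyXU bform_mul_mono mxE; congr (_ *: _).
by rewrite (nth_map ord0) ?size_enum_ord // nth_ord_enum.
Qed.

Lemma poncelet_formM (K : fieldType) (n k : nat)
    (B : 'M[K]_((n + k).+1, k.+1)) (C : 'M[K]_k.+1) (A : 'M[K]_n.+1) :
  poncelet_form (B *m C) A = \det C *: poncelet_form B A.
Proof.
rewrite -mul_mpolyC mulrC -det_map_mx -det_mulmx; congr (\det _).
apply/matrixP => a b; rewrite !mxE.
under [RHS]eq_bigr => c _ do rewrite !mxE big_distrl /=.
rewrite exchange_big; apply: eq_bigr => j _ /=.
rewrite mxE scaler_suml; apply: eq_bigr => c _.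
by rewrite [RHS]mulrC (mul_mpolyC (C c b)) scalerA mulrC.
Qed.

Lemma map_poncelet_form (R S : comNzRingType) (f : {rmorphism R -> S}) (n k : nat)
    (B : 'M[R]_((n + k).+1, k.+1)) (A : 'M[R]_n.+1) :
  map_mpoly f (poncelet_form B A)
    = poncelet_form (map_mx f B) (map_mx f A).
Proof.
rewrite -det_map_mx; congr (\det _); apply/matrixP => a b.
rewrite !mxE raddf_sum; apply: eq_bigr => j _ /=.
rewrite map_mpolyZ [in RHS]mxE; congr (_ *: _); rewrite (raddf_sum (map_mpoly f)) /=.
by apply: eq_bigr => l _; rewrite map_mpolyZ map_mpolyX mxE.
Qed.

(** * Normal form of the quotient map *)

(** The identity matrix in the rows that g sends to the left summand, rows of Y
    in the others. *)
Definition pivot_mx {R : nzRingType} {N r n : nat} (g : 'I_N -> 'I_r + 'I_n)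
    (Y : 'M[R]_(n, r)) : 'M[R]_(N, r) :=
  \matrix_(i, b) match g i with inl j => (j == b)%:R | inr l => Y l b end.

(** Choose r independent rows of Q as pivots and let C be the submatrix that
    they form: then Q C^-1 has the identity in these rows. *)
Lemma row_full_pivot (K : fieldType) (N r n : nat) (Q : 'M[K]_(N, r)) :
  N = (r + n)%N -> row_full Q ->
  exists (g : {ffun 'I_N -> 'I_r + 'I_n}) (Y : 'M[K]_(n, r)) (C : 'M[K]_r),
    Q = pivot_mx g Y *m C.
Proof.
move=> Nrn fQ; pose f := fullrankfun fQ; pose C := rowsub f Q.
have Cu : C \in unitmx by apply: fullrowsub_unit.
have finj : injective f by apply: fullrankfun_inj.
pose A := ~: [set f j | j in 'I_r].
have cA : #|A| = n.
  by rewrite cardsCs setCK card_imset // !card_ord Nrn addKn.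
pose e (l : 'I_n) : 'I_N := enum_val (cast_ord (esym cA) l).
(* The map h lists the pivot rows, then the others; it is a bijection, and its
   inverse is the required pattern g. *)
pose h (y : 'I_r + 'I_n) := match y with inl j => f j | inr l => e l end.
have eA l : e l \in A by apply: enum_valP.
have hinj : injective h.
  move=> [j|l] [j'|l'] /=.
  - by move/finj=> ->.
  - by move=> E; have := eA l'; rewrite -E inE imset_f.
  - by move=> E; have := eA l; rewrite E inE imset_f.
  - by move/enum_val_inj/cast_ord_inj=> ->.
have [g hK gK] : bijective h.
  by apply: inj_card_bij hinj _; rewrite card_sum !card_ord Nrn.
exists (finfun g), (rowsub e Q *m invmx C), C.
apply/row_matrixP => i; rewrite row_mul -[in LHS](gK i).
case gi : (g i) => [j|l] /=.
  have -> : row i (pivot_mx (finfun g) (rowsub e Q *m invmx C)) = delta_mx 0 j.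
    by apply/rowP => b; rewrite !mxE ffunE gi eqxx eq_sym.
  by rewrite -rowE; apply/rowP => b; rewrite !mxE.
have -> : row i (pivot_mx (finfun g) (rowsub e Q *m invmx C))
    = row l (rowsub e Q *m invmx C).
  by apply/rowP => b; rewrite [LHS]mxE mxE ffunE gi [RHS]mxE.
by rewrite -row_mul mulmxKV //; apply/rowP => b; rewrite !mxE.
Qed.

Lemma limg_row_full (K : fieldType) (i r : nat)
    (q : 'Hom(bform K i, 'rV[K]_r)) :
  limg q = fullv ->
  row_full (\matrix_(j < i.+1, b < r) q (bform_mono K j) 0 b).
Proof.
move=> qf; rewrite -sub1mx; apply/rV_subP => v _.
have /memv_imgP [h _ ->] : v \in limg q by rewrite qf memvf.
rewrite (bform_mono_span K i h) linear_sum /=; apply: summx_sub => j _.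
rewrite linearZ scalemx_sub // (eq_row_sub j) //.
by apply/rowP => b; rewrite !mxE.
Qed.

Lemma poncelet_normal_form (K : fieldType) (n k : nat) (F : {mpoly K[n.+1]}) :
  poncelet_hypersurface k F ->
  exists (g : {ffun 'I_(n + k).+1 -> 'I_k.+1 + 'I_n}) (Y : 'M[K]_(n, k.+1))
         (A : 'M[K]_n.+1) (c : K),
    F = c *: poncelet_form (pivot_mx g Y) A.
Proof.
move=> [A [_ [c [_ [f [q [_ _ qf ->]]] _ ->]]]].
have Nkn : (n + k).+1 = (k.+1 + n)%N by rewrite addSn addnC.
have [g [Y [C QE]]] :=
  row_full_pivot K _ _ n _ Nkn (limg_row_full K (n + k) k.+1 q qf).
exists g, Y, A, (c * \det C).
by rewrite linear_subst_poncelet QE poncelet_formM scalerA.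
Qed.

(** * The universal Poncelet form *)

(** Index type of the parameters: the entries of Y, the entries of A, and the
    scalar factor. *)
Definition param (n k : nat) : finType :=
  ('I_n * 'I_k.+1 + 'I_n.+1 * 'I_n.+1 + unit)%type.

Lemma card_param (n k : nat) : #|param n k| = (n * k.+1 + n.+1 ^ 2).+1.
Proof. by rewrite !card_sum !card_prod !card_ord card_unit addn1. Qed.

(** All Poncelet forms with pivot pattern g at once: the entries of Y and A and
    the scalar factor are indeterminates. *)
Definition universal_form (K : fieldType) {n k : nat}
    (g : 'I_(n + k).+1 -> 'I_k.+1 + 'I_n) :
    {mpoly {mpoly K[#|param n k|]}[n.+1]} :=
  let X (t : param n k) : {mpoly K[#|param n k|]} := 'X_(enum_rank t) in
  X (inr tt) *: poncelet_form (pivot_mx g (\matrix_(l, b) X (inl (inl (l, b)))))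
                              (\matrix_(j, l) X (inl (inr (j, l)))).

Lemma universal_form_specialization (K : fieldType) (n k : nat)
    (g : 'I_(n + k).+1 -> 'I_k.+1 + 'I_n) (Y : 'M[K]_(n, k.+1))
    (A : 'M[K]_n.+1) (c : K) :
  exists x : 'I_(#|param n k|) -> K,
    map_mpoly (meval x) (universal_form K g) = c *: poncelet_form (pivot_mx g Y) A.
Proof.
pose y (t : param n k) : K := match t with
  | inl (inl (l, b)) => Y l b
  | inl (inr (j, l)) => A j l
  | inr _ => c end.
pose x (i : 'I_(#|param n k|)) := y (enum_val i).
have Xx (t : param n k) : meval x 'X_(enum_rank t) = y t.
  by rewrite mevalXU /x enum_rankK.
exists x; rewrite map_mpolyZ map_poncelet_form [X in X *: _]Xx.
rewrite [X in poncelet_form X _](_ : _ = pivot_mx g Y); last first.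
  apply/matrixP => i b; rewrite !mxE; case: (g i) => l; first exact: rmorph_nat.
  by rewrite mxE [LHS]Xx.
rewrite [X in poncelet_form _ X](_ : _ = A) //.
by apply/matrixP => i j; rewrite !mxE [LHS]Xx.
Qed.

(** * General hypersurfaces *)

(** The left side of the hypothesis is one more than the number of parameters of
    a Poncelet form in normal form, the right side is the number of coefficients
    of a form of degree k + 1. *)
Theorem general_not_poncelet (K : numFieldType) (n k : nat) :
  ((n * k.+1 + n.+1 ^ 2).+2 < 'C(k.+1 + n, k.+1))%N ->
  exists U : dhomog n.+1 K k.+1 -> Prop,
    [/\ proj_zariski_open U, (exists2 F, F != 0 & U F)
      & forall F : dhomog n.+1 K k.+1, U F -> ~ poncelet_hypersurface k F].
Proof.
set W := dhomog n.+1 K k.+1.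
have -> : 'C(k.+1 + n, k.+1) = \dim {:W} by rewrite dimvf.
rewrite -card_param => lt_dim.
have [G [G0 [e Ge] GP]] := common_homogeneous_relation K
  {ffun 'I_(n + k).+1 -> 'I_k.+1 + 'I_n} _ _
  (fun g => coords_poly k.+1 (universal_form K g)) lt_dim.
exists (fun F => eval_at G F != 0); split.
- exists (eq G); split=> [_ <-|F _]; first by exists e.
  by split=> [GF|[_ <-]] //; exists G.
- pose i0 : 'I_(\dim {:W}) := Ordinal (leq_ltn_trans (leq0n _) lt_dim).
  (* The factor 'X_i0 makes the point found below nonzero. *)
  have [v] : exists v : 'I_(\dim {:W}) -> K, (G * 'X_i0).@[v] != 0.
    apply: mpoly_nonroot; rewrite mulf_neq0 //.
    by rewrite -msize_poly_eq0 msizeX.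
  rewrite mevalM mevalXU mulf_eq0 negb_or => /andP [Gv vi0].
  pose F : W := \sum_i v i *: (vbasis {:W})`_i.
  have Fv i : coord (vbasis {:W}) i F = v i.
    exact: coord_sum_free (basis_free (vbasisP _)).
  exists F; last by rewrite /eval_at (meval_eq _ Fv).
  by apply: contraNneq vi0 => F0; rewrite -Fv F0 linear0.
- move=> F /negP GF /poncelet_normal_form [g [Y [A [c FE]]]]; apply: GF.
  have [x xE] := universal_form_specialization K n k g Y A c.
  rewrite (eval_at_specialization K _ n k.+1 (universal_form K g) x) ?FE //.
  by rewrite GP meval0.
Qed.

(** Equivalently 3 d + 18 < C(d + 3, 3). For d = 4 this reads 30 < 35, and the
    right side grows faster. *)
Lemma parameter_count (d : nat) :
  (4 <= d)%N -> ((3 * d + 4 ^ 2).+2 < 'C(d + 3, d))%N.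
Proof.
move=> d4; have -> : 'C(d + 3, d) = 'C(d + 3, 3).
  by rewrite -(bin_sub (leq_addl d 3)) addnK.
rewrite -(subnKC d4); elim: (d - 4)%N => // e IH.
apply: (@leq_trans (3 + (3 * (4 + e) + 4 ^ 2).+3)).
  by rewrite addnS mulnS -addnA !addnS.
rewrite [(4 + e.+1)%N]addnS [((4 + e).+1 + 3)%N]addSn binS (addnC 3) leq_add //.
by apply: (@leq_trans 'C(3, 2)); last by rewrite leq_bin2l // leq_addl.
Qed.

Theorem mainTheorem3 (R : realType) (d : nat) (hd : (4 <= d)%N) :
  exists U : dhomog 4 R[i] d -> Prop,
    [/\ proj_zariski_open U,
        (exists2 F : dhomog 4 R[i] d, F != 0 & U F)
      & forall F : dhomog 4 R[i] d, F != 0 -> U F -> ~ poncelet_surface d F].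
Proof.
case: d hd => // k hd.
have [U [Uo Une UP]] := general_not_poncelet R[i] 3 k (parameter_count _ hd).
by exists U; split=> // F _; apply: UP.
Qed.
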